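(* Let $d\geq 1$ be an integer, let $A,\alpha,M\geq 0$ and let $f:\mathbf{R}^d\to\mathbf{C}$ satisfy: (a) for all $x\in\mathbf{R}^d$, $|f(x)|\leq 1$; (b) for all $x,x'\in\mathbf{R}^d$, $$|f(x)-f(x')|\leq A|x-x'|^\alpha\bigl(1+\max(|x|,|x'|)\bigr)^M.$$ Then, for all $0<\rho\leq 1$ and all $x,x'\in\mathbf{R}^d$, $$|f(x)-f(x')|\leq \max(2,A)\,|x-x'|^{\rho\alpha}\bigl(1+\max(|x|,|x'|)\bigr)^{\rho M}.$$
   Context: $|x|$ denotes the Euclidean norm of $x\in\mathbf{R}^d$, and $|z|$ the modulus of $z\in\mathbf{C}$. *)

(* Defs.v *)
From mathcomp Require Import all_boot all_order all_algebra.
From mathcomp Require Import complex.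
From mathcomp Require Import reals exp.

Set Implicit Arguments.
Unset Strict Implicit.
Unset Printing Implicit Defensive.

Import Order.TTheory GRing.Theory Num.Theory.
Local Open Scope ring_scope.

(* The library's norm on 'rV[R]_d is the sup norm. *)
Definition enorm (R : realType) (d : nat) (x : 'rV[R]_d) : R :=
  Num.sqrt (\sum_(i < d) x ord0 i ^+ 2).

(* Main.v *)
(* Both [|f x - f x'| <= K] and [|f x - f x'| <= K t] hold with [K = max(2, A)] and [t = |x - x'|^alpha (1 + max(|x|, |x'|))^M]; hence so does the bound by [K t^rho], as [min(1, t) <= t^rho] for [0 < rho <= 1]. *)
Require Import Defs.
From mathcomp Require Import all_boot all_order all_algebra.
From mathcomp Require Import complex.
From mathcomp Require Import reals exp.

Import Order.TTheory GRing.Theory Num.Theory.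

Local Open Scope ring_scope.

(** If [1 <= t], the power is at least t^0 = 1; if [0 < t <= 1], an exponent in [0, 1] does not
    decrease [t]. *)
Lemma min1_le_powR (R : realType) (t r : R) :
  0 <= t -> 0 <= r -> r <= 1 -> Num.min 1 t <= t `^ r.
Proof.
move=> t0 r0 r1; rewrite ge_min; have [t1|/ltW t1] := leP 1 t.
  by rewrite -[X in X <= _](powRr0 t) ler_powR.
(* The comparison of [t] with t^r below needs a positive base; at [t = 0] nonnegativity of the power
   suffices. *)
have [->|tneq0] := eqVneq t 0; first by rewrite powR_ge0 orbT.
by rewrite ger1_powR ?orbT// lt_def tneq0 t0.
Qed.

Lemma normc_sub_le2 (R : rcfType) (a b : R[i]) :
  ComplexField.Normc.normc a <= 1 -> ComplexField.Normc.normc b <= 1 ->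
  ComplexField.Normc.normc (a - b) <= 2.
Proof.
move=> a1 b1; apply: (le_trans (le_normcD a (- b))).
by rewrite normcN -[2]/(1 + 1) lerD.
Qed.

Theorem lemma1 (R : realType) (d : nat) (hd : (1 <= d)%N)
  (A alpha M : R) (hA : 0 <= A) (halpha : 0 <= alpha) (hM : 0 <= M)
  (f : 'rV[R]_d -> R[i])
  (f_le1 : forall x, ComplexField.Normc.normc (f x) <= 1)
  (f_holder : forall x x',
     ComplexField.Normc.normc (f x - f x') <=
       A * enorm (x - x') `^ alpha
         * (1 + Num.max (enorm x) (enorm x')) `^ M) :
  forall rho : R, 0 < rho -> rho <= 1 -> forall x x' : 'rV[R]_d,
    ComplexField.Normc.normc (f x - f x') <=
      Num.max 2 A * enorm (x - x') `^ (rho * alpha)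
        * (1 + Num.max (enorm x) (enorm x')) `^ (rho * M).
Proof.
move=> rho /ltW rho0 rho1 x x'.
have w0 : 0 <= 1 + Num.max (enorm x) (enorm x').
  by rewrite addr_ge0// le_max sqrtr_ge0.
(* Moving [rho] to the right in each exponent makes it the outer power, so the two factors merge
   into t^rho. *)
rewrite -mulrA ![rho * _]mulrC !powRrM -powRM ?powR_ge0//.
have := f_holder x x'; rewrite -mulrA; set t := _ * _ `^ M => le_At.
have t0 : 0 <= t by rewrite mulr_ge0 ?powR_ge0.
have K0 : 0 <= Num.max 2 A by rewrite le_max hA orbT.
apply: le_trans (_ : Num.max 2 A * Num.min 1 t <= _); last first.
  by rewrite ler_wpM2l// min1_le_powR.
(* The minimum splits into two bounds: by [Num.max 2 A], from the bound on [f], and by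
   [Num.max 2 A * t], from the Hölder hypothesis. *)
rewrite minr_pMr// mulr1 le_min; apply/andP; split.
  by rewrite le_max normc_sub_le2.
by apply: le_trans le_At _; rewrite ler_wpM2r// le_max lexx orbT.
Qed.
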